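(* Let $k\ge 2$, let $0<p<1$, and let $\pi$ and $\pi'$ be proper partitions of $k$. Then $\mathrm{Expand}_p[\pi]\Rightarrow\mathrm{Expand}_p[\pi']$ (that is, every sequence $\{H_n\}_{n\to\infty}$ of $k$-uniform hypergraphs with $|V(H_n)|=n$ satisfying $\mathrm{Expand}_p[\pi]$ also satisfies $\mathrm{Expand}_p[\pi']$) if and only if $\pi'$ is a refinement of $\pi$.
   Context: A $k$-uniform hypergraph $H$ is a pair of finite sets $(V(H),E(H))$ where $E(H)$ is a collection of $k$-subsets of $V(H)$. A proper partition $\pi=k_1+\dots+k_t$ of $k$ is an unordered list of at least two positive integers whose sum is $k$. A partition $\pi'=m_1+\dots+m_r$ is a refinement of $\pi=k_1+\dots+k_t$ if there is a surjection $\phi:\{1,\dots,r\}\to\{1,\dots,t\}$ such that $k_i=\sum_{j:\phi(j)=i}m_j$ for every $1\le i\le t$. For a fixed real $0<p<1$ and a proper partition $\pi=k_1+\dots+k_t$ of $k$, a sequence $\{H_n\}_{n\to\infty}$ of $k$-uniform hypergraphs with $|V(H_n)|=n$ satisfies $\mathrm{Expand}_p[\pi]$ if for all $S_i\subseteq\binom{V(H_n)}{k_i}$, $1\le i\le t$, $$e(S_1,\dots,S_t)=p\prod_{i=1}^t|S_i|+o(n^k),$$ where $e(S_1,\dots,S_t)$ is the number of tuples $(s_1,\dots,s_t)$ with $s_i\in S_i$ for all $i$ and $s_1\cup\dots\cup s_t\in E(H_n)$. The $o(n^k)$ term is uniform: there is $f:\mathbb{N}\to\mathbb{R}$ with $f(n)/n^k\to0$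 bounding the absolute error for all $n$ and all choices of $S_1,\dots,S_t$. *)

(* Defs.v *)
From mathcomp Require Import all_boot all_order all_algebra.
From mathcomp Require Import all_classical all_reals all_analysis.

Set Implicit Arguments.
Unset Strict Implicit.
Unset Printing Implicit Defensive.

Import Order.TTheory GRing.Theory Num.Theory.
Import numFieldNormedType.Exports.

Local Open Scope ring_scope.

(* Unordered lists of integers are represented by arbitrary listings of their
   parts; all the notions below are invariant under reordering a listing. *)
Definition proper_partition (k : nat) (lam : seq nat) : Prop :=
  [/\ (2 <= size lam)%N, all (fun m => (0 < m)%N) lam & sumn lam = k].

Definition refinement (lam' lam : seq nat) : Prop :=
  exists phi : 'I_(size lam') -> 'I_(size lam),
    (forall i, exists j, phi j = i) /\
    (forall i : 'I_(size lam),
       nth 0%N lam i = (\sum_(j < size lam' | phi j == i) nth 0%N lam' j)%N).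

Record uniform_hypergraph (k : nat) := UniformHypergraph {
  vertex : finType;
  edges : {set {set vertex}};
  edges_card : forall A : {set vertex}, A \in edges -> #|A| = k }.

Definition ksubsets (T : finType) (j : nat) : {set {set T}} :=
  [set A : {set T} | #|A| == j]%SET.

Definition edge_tuples (k t : nat) (H : uniform_hypergraph k)
    (S : 'I_t -> {set {set vertex H}}) : {set {ffun 'I_t -> {set vertex H}}} :=
  [set s : {ffun 'I_t -> {set vertex H}} |
    [forall i, s i \in S i] && ((\bigcup_(i < t) s i)%SET \in edges H)]%SET.

Definition Expand (R : realType) (p : R) (k : nat) (lam : seq nat)
    (H : nat -> uniform_hypergraph k) : Prop :=
  exists f : nat -> R,
    ((fun n : nat => f n / n%:R ^+ k) @ \oo --> (0 : R))%classic /\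
    forall (n : nat) (S : 'I_(size lam) -> {set {set vertex (H n)}}),
      (forall i, S i \subset ksubsets (vertex (H n)) (nth 0%N lam i)) ->
      `| #|edge_tuples S|%:R - p * \prod_(i < size lam) #|S i|%:R | <= f n.

(* Main.v *)
Require Import Defs.
From mathcomp Require Import all_boot all_order all_algebra.
From mathcomp Require Import all_classical all_reals all_analysis.
From mathcomp Require Import zify ring lra.
From mathcomp Require Import fintype bigop finset perm.

Set Implicit Arguments.
Unset Strict Implicit.
Unset Printing Implicit Defensive.

Import Order.TTheory GRing.Theory Num.Theory.
Import numFieldNormedType.Exports.

Local Open Scope ring_scope.

(** Why the theorem holds.

    Both implications work with tuples of vertices instead of families of sets.
    Positions are cut into blocks, one for each part of the partition, and
    [tuple_bounded] says that every test which is a conjunction of conditions on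
    single blocks sees the edges with density [p], up to a given error.  This is
    equivalent, up to constants and an error of order [n ^ (k - 1)], to the same
    statement for families of sets ([set_of_tuple_bounded],
    [tuple_of_set_bounded]).

    If the second partition refines the first, each of its blocks lies inside a
    block of the first one, so a conjunction of conditions on the finer blocks
    is a conjunction of conditions on the coarser ones
    ([Expand_of_refinement]).

    If it does not, write the second partition as [m_1 + ... + m_r].  A
    hypergraph that separates the two properties is explicit.  Vertices carry a
    colour among [r] and two labels [l1], [l2] in a prime field [F_q], where
    [q ^ 2 <= n] and [q] grows with [n].  For a set [A] put
    [G A = (sum of l1 over A) ^ 2 + (sum of l2 over A)].  A [k]-set having
    exactly [m_j] vertices of colour [j] for all [j] is an edge when the sum of
    [G] over its colour classes lies in a fixed set [K] of about [p * q] field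
    elements; any other [k]-set is an edge when its own value of [G] lies in
    [K].

    This hypergraph passes all tests on the first partition.  Since there is no
    refinement, some colour class of the first kind of set must meet two blocks
    ([crossing_pair]), and for the other sets any two blocks do.  With all
    vertices but one in each of these two blocks fixed, the quadratic form is
    twice the product of the [l1] labels of the two free vertices plus terms in
    one of them ([quadratic_update]); as [q] is odd, the factor two does no
    harm, and [l2] makes the values pairwise independent.  A second moment
    computation then bounds the deviation by [O (n ^ 2 / sqrt q)]
    ([bilinear_discrepancy]).

    It fails the second partition: by averaging there are translates of a short
    interval such that, for each [j], a positive proportion of the
    [m_j]-subsets of colour class [j] have their value of [G] in the [j]-th
    translate.  Values from these translates always add up to an element of
    [K], so these families span edges with density one ([planted_family]). *)

(** * Tuples and coordinate changes *)

Definition update (P V : finType) (x : {ffun P -> V}) (u : P) (a : V) :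
  {ffun P -> V} := [ffun w => if w == u then a else x w].

Definition tuple_range (P V : finType) (x : {ffun P -> V}) : {set V} :=
  [set x u | u in [set: P]].

(** Averaging over one coordinate: the change of variables
    [(x, a) -> (update x u a, x u)] is an involution of pairs. *)
Lemma sum_update (R : nmodType) (P V : finType) (u : P)
    (F : {ffun P -> V} -> R) :
  \sum_x \sum_a F (update x u a) = (\sum_x F x) *+ #|V|.
Proof.
rewrite pair_big /=.
have swapK : involutive (fun z : {ffun P -> V} * V => (update z.1 u z.2, z.1 u)).
  move=> [x a] /=; rewrite ffunE eqxx; congr pair.
  by apply/ffunP => w; rewrite !ffunE; case: eqP => // ->.
rewrite (reindex_inj (inv_inj swapK)) /=.
rewrite (eq_bigr (fun z : {ffun P -> V} * V => F z.1)); last first.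
  by move=> [x a] _ /=; congr F; apply/ffunP => w; rewrite !ffunE;
    case: eqP => // ->.
rewrite -(pair_big xpredT xpredT (fun x _ => F x)) /=.
by rewrite -sumrMnl; apply: eq_bigr => x _; rewrite sumr_const.
Qed.

Lemma card_eq_coordinates (P V : finType) (u v : P) : u != v ->
  (#|[set x : {ffun P -> V} | x u == x v]| * #|V| = #|V| ^ #|P|)%N.
Proof.
rewrite eq_sym => vu; rewrite -card_ffun -sum1_card big_mkcond /=.
have := sum_update u (fun x : {ffun P -> V} => (x u == x v : nat)).
rewrite /= -[_ *+ _]mulr_natr /GRing.mul /= => E.
rewrite natn in E.
rewrite (eq_bigr (fun x : {ffun P -> V} => (x u == x v : nat))); last first.
  by move=> x _; rewrite inE; case: eqP.
rewrite -[LHS]E -sum1_card; apply: eq_bigr => x _.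
rewrite (bigD1 (x v)) //= big1 ?addn0 => [|a /negbTE av].
  by rewrite !ffunE eqxx (negbTE vu) eqxx.
by rewrite !ffunE eqxx (negbTE vu) av.
Qed.

(** A tuple with a repetition lies on one of the diagonals [x u = x v]. *)
Lemma card_noninjective (P V : finType) :
  (#|[set x : {ffun P -> V} | ~~ injectiveb x]| * #|V|
     <= #|P| ^ 2 * #|V| ^ #|P|)%N.
Proof.
pose D (z : P * P) := [set x : {ffun P -> V} | x z.1 == x z.2].
have sub : [set x : {ffun P -> V} | ~~ injectiveb x]
    \subset \bigcup_(z | z.1 != z.2) D z.
  apply/subsetP => x; rewrite inE => /injectivePn[u [v uv xuv]].
  by apply/bigcupP; exists (u, v); rewrite ?inE //= xuv.
apply: (@leq_trans ((\sum_(z : P * P | z.1 != z.2) #|D z|) * #|V|)).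
  rewrite leq_mul2r; apply/orP; right.
  apply: leq_trans (subset_leq_card sub) _.
  elim/big_rec2: _ => [|z A m _ IH]; first by rewrite cards0.
  by apply: leq_trans (leq_card_setU _ _) _; rewrite leq_add2l.
rewrite big_distrl /= (eq_bigr (fun=> (#|V| ^ #|P|)%N)); last first.
  by move=> z zz; apply: card_eq_coordinates.
rewrite sum_nat_const leq_mul2r; apply/orP; right.
by rewrite -mulnn -card_prod max_card.
Qed.

(** * From families of sets to tuples and back *)

Definition block (P I : finType) (b : P -> I) (i : I) : {set P} :=
  [set u | b u == i].

Definition part (P V I : finType) (b : P -> I) (x : {ffun P -> V}) (i : I) :
  {set V} := [set x u | u in block b i].

Definition block_injective (P V I : finType) (b : P -> I) (x : {ffun P -> V}) :=
  [forall i, #|part b x i| == #|block b i|].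

Definition block_local (P V I : finType) (b : P -> I)
    (g : I -> {ffun P -> V} -> bool) : Prop :=
  forall i (x y : {ffun P -> V}), (forall u, b u = i -> x u = y u) -> g i x = g i y.

(** A chosen listing of the set [B] by the positions of the block [i]; only its
    values on that block matter. *)
Definition listing (P V I : finType) (b : P -> I) (x0 : {ffun P -> V}) (i : I)
    (B : {set V}) : {ffun P -> V} :=
  odflt x0 [pick x | part b x i == B].

Definition assemble (P V I : finType) (b : P -> I) (x0 : {ffun P -> V})
    (s : {ffun I -> {set V}}) : {ffun P -> V} :=
  [ffun u => listing b x0 (b u) (s (b u)) u].

Definition canonical_tuple (P V I : finType) (b : P -> I) (x0 x : {ffun P -> V}) :=
  x == assemble b x0 [ffun i => part b x i].

Lemma part_listing (P V I : finType) (b : P -> I) (x0 : {ffun P -> V}) i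
    (B : {set V}) : #|B| = #|block b i| -> part b (listing b x0 i B) i = B.
Proof.
move=> cB; rewrite /listing; case: pickP => [x /eqP // | none] /=.
suff [x xB] : exists x : {ffun P -> V}, part b x i = B.
  by have := none x; rewrite xB eqxx.
have lt_index u : u \in block b i -> (index u (enum (block b i)) < size (enum B))%N.
  by rewrite -cardE cB cardE index_mem mem_enum.
exists [ffun u => nth (x0 u) (enum B) (index u (enum (block b i)))].
apply/setP => v; apply/imsetP/idP => [[u ui ->]|vB].
  by rewrite ffunE -mem_enum mem_nth ?lt_index.
have lt_v : (index v (enum B) < size (enum (block b i)))%N.
  by rewrite -cardE -cB cardE index_mem mem_enum.
have ex_u : exists u, u \in block b i.
  by apply/card_gt0P; rewrite -cB; apply/card_gt0P; exists v.
case: ex_u => u0 _; exists (nth u0 (enum (block b i)) (index v (enum B))).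
  by rewrite -mem_enum mem_nth.
by rewrite ffunE index_uniq ?enum_uniq // nth_index // mem_enum.
Qed.

Lemma part_assemble (P V I : finType) (b : P -> I) (x0 : {ffun P -> V})
    (s : {ffun I -> {set V}}) : (forall i, #|s i| = #|block b i|) ->
  forall i, part b (assemble b x0 s) i = s i.
Proof.
move=> cs i; rewrite -[RHS](part_listing x0 (cs i)).
by apply: eq_in_imset => u; rewrite inE ffunE => /eqP ->.
Qed.

Lemma tuple_range_part (P V I : finType) (b : P -> I) (x : {ffun P -> V}) :
  tuple_range x = \bigcup_i part b x i.
Proof.
apply/setP => v; apply/imsetP/bigcupP => [[u _ ->]|[i _ /imsetP[u _ ->]]].
  by exists (b u) => //; apply/imsetP; exists u; rewrite ?inE.
by exists u.
Qed.

Lemma block_injectiveP (P V I : finType) (b : P -> I) (x : {ffun P -> V}) :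
  reflect (forall u v, b u = b v -> x u = x v -> u = v) (block_injective b x).
Proof.
apply: (iffP forallP) => [inj u v buv xuv|inj i].
  have /imset_injP := inj (b u); apply=> //; by rewrite inE // buv.
by apply/imset_injP => u v; rewrite !inE => /eqP bu /eqP bv; apply: inj; rewrite bv.
Qed.

(** Listing the sets of a family and taking the parts of a tuple are inverse to
    each other between families of sets of the right sizes and canonical tuples
    that are injective on every block. *)
Lemma sum_canonical (R : nmodType) (P V I : finType) (b : P -> I)
    (x0 : {ffun P -> V}) (F : {ffun P -> V} -> R) :
  \sum_(x | block_injective b x && canonical_tuple b x0 x) F x =
  \sum_(s : {ffun I -> {set V}} | [forall i, #|s i| == #|block b i|])
     F (assemble b x0 s).
Proof.
rewrite (reindex_onto (assemble b x0) (fun x => [ffun i => part b x i])) /=.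
  apply: eq_bigl => s; apply/idP/forallP.
    move=> /andP[/andP[/forallP inj _] /eqP <-] i.
    by rewrite ffunE; apply: inj.
  move=> cs; have parts := part_assemble x0 (fun i => eqP (cs i)).
  have ->: [ffun i => part b (assemble b x0 s) i] = s.
    by apply/ffunP => i; rewrite ffunE parts.
  rewrite eqxx andbT; apply/andP; split.
    by apply/forallP => i; rewrite parts.
  by apply/eqP; congr assemble; apply/ffunP => i; rewrite ffunE parts.
by move=> x /andP[_ /eqP].
Qed.

Lemma part_perm (P V I : finType) (b : P -> I) (x : {ffun P -> V})
    (s : {perm P}) (bs : forall u, b (s u) = b u) i :
  part b [ffun u => x (s u)] i = part b x i.
Proof.
apply/setP => v; apply/imsetP/imsetP => [[u ui ->]|[u ui ->]].
  by exists (s u); rewrite ?ffunE //; move: ui; rewrite !inE bs.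
exists (s^-1 u)%g; last by rewrite ffunE permKV.
by move: ui; rewrite !inE -[in b u](permKV s u) bs.
Qed.

(** Every block-injective tuple is, up to a unique reordering inside the blocks,
    canonical: both listings enumerate the same parts. *)
Lemma unique_reordering (P V I : finType) (b : P -> I) (x0 x : {ffun P -> V}) :
  block_injective b x ->
  exists s0 : {perm P}, forall s : {perm P},
    [forall u, b (s u) == b u] && canonical_tuple b x0 [ffun u => x (s u)]
      = (s == s0).
Proof.
move=> xinj; have inj := block_injectiveP b x xinj.
set parts := [ffun i => part b x i].
have cparts i : #|parts i| = #|block b i|.
  by rewrite ffunE; move/forallP: xinj => /(_ i)/eqP.
set y := assemble b x0 parts.
have party i : part b y i = parts i by apply: part_assemble.
have yinj : block_injective b y by apply/forallP => i; rewrite party cparts.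
(* The canonical listing y of the parts of x runs through the same vertices. *)
have ex_w u : exists w, (b w == b u) && (x w == y u).
  have : y u \in part b y (b u) by apply/imsetP; exists u; rewrite ?inE.
  rewrite party [parts _]ffunE => /imsetP[w]; rewrite inE => bw ->.
  by exists w; rewrite bw eqxx.
pose s u := xchoose (ex_w u).
have sP u : b (s u) = b u /\ x (s u) = y u.
  by have /andP[/eqP ? /eqP ?] := xchooseP (ex_w u).
have s_inj : injective s.
  move=> u v suv; apply: (block_injectiveP b y yinj).
    by rewrite -(sP u).1 -(sP v).1 suv.
  by rewrite -(sP u).2 -(sP v).2 suv.
exists (perm s_inj) => r; apply/andP/eqP => [[/forallP br /eqP can]|->].
  apply/permP => u; rewrite permE; apply: inj.
    by rewrite (eqP (br u)) (sP u).1.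
  rewrite (sP u).2.
  have -> : x (r u) = [ffun u => x (r u)] u by rewrite ffunE.
  rewrite can; congr ((assemble _ _ _ : {ffun _ -> _}) _).
  by apply/ffunP => i; rewrite !ffunE part_perm // => w; apply/eqP.
have bs u : b (perm s_inj u) = b u by rewrite permE (sP u).1.
split; first by apply/forallP => u; rewrite bs.
have -> : [ffun u => x (perm s_inj u)] = y.
  by apply/ffunP => u; rewrite ffunE permE (sP u).2.
apply/eqP; congr assemble; apply/ffunP => i.
by rewrite ffunE party.
Qed.

Definition tuple_bounded (R : realFieldType) (P V I : finType) (b : P -> I)
    (E : {set {set V}}) (p M : R) : Prop :=
  forall g : I -> {ffun P -> V} -> bool, block_local b g ->
  `|\sum_x [forall i, g i x]%:R * ((tuple_range x \in E)%:R - p)| <= M.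

Definition family_deviation (R : realFieldType) (V I : finType)
    (E : {set {set V}}) (p : R) (S : I -> {set {set V}}) : R :=
  #|[set s : {ffun I -> {set V}} |
      [forall i, s i \in S i] && (\bigcup_i s i \in E)]|%:R
    - p * \prod_i #|S i|%:R.

Definition set_bounded (R : realFieldType) (V I : finType) (c : I -> nat)
    (E : {set {set V}}) (p M : R) : Prop :=
  forall S : I -> {set {set V}},
  (forall i, S i \subset [set A : {set V} | #|A| == c i]) ->
  `|family_deviation E p S| <= M.

Lemma prod_card_families (R : realFieldType) (V I : finType)
    (S : I -> {set {set V}}) :
  \prod_i #|S i|%:R =
  \sum_(s : {ffun I -> {set V}}) [forall i, s i \in S i]%:R :> R.
Proof.
transitivity (\prod_i \sum_(A : {set V}) (A \in S i)%:R : R).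
  apply: eq_bigr => i _; rewrite -sum1_card natr_sum big_mkcond /=.
  by apply: eq_bigr => A _; case: ifP.
rewrite bigA_distr_bigA; apply: eq_bigr => s _.
case: forallP => [all|nall].
  by rewrite big1 // => i _; rewrite all.
have [i /negbTE ni] : exists i, s i \notin S i.
  apply/existsP; rewrite -negb_forall; apply/negP => /forallP.
  exact: nall.
by rewrite (bigD1 i) //= ni mul0r.
Qed.

Lemma family_deviationE (R : realFieldType) (V I : finType)
    (E : {set {set V}}) (p : R) (S : I -> {set {set V}}) :
  family_deviation E p S =
  \sum_(s : {ffun I -> {set V}}) [forall i, s i \in S i]%:R *
     ((\bigcup_i s i \in E)%:R - p).
Proof.
rewrite /family_deviation prod_card_families.
rewrite -sum1_card natr_sum big_mkcond mulr_sumr -sumrB /=.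
apply: eq_bigr => s _; rewrite inE.
by case: [forall i, _]; case: (_ \in E) => /=; ring.
Qed.

(** Listing every set of a family by its block turns a family of sets into a
    tuple, and turns membership in [S i] into a condition on the block [i]. *)
Lemma set_of_tuple_bounded (R : realFieldType) (P V I : finType) (b : P -> I)
    (c : I -> nat) (E : {set {set V}}) (p M : R) :
  (0 < #|V|)%N -> (forall i, #|block b i| = c i) ->
  tuple_bounded b E p M -> set_bounded c E p M.
Proof.
move=> /card_gt0P[v0 _] cb bounded S Sc.
pose x0 : {ffun P -> V} := [ffun => v0].
pose g i (x : {ffun P -> V}) := (part b x i \in S i) &&
  [forall u, (b u == i) ==> (x u == listing b x0 i (part b x i) u)].
have glocal : block_local b g.
  move=> i x y xy.
  have pxy : part b x i = part b y i.
    by apply: eq_in_imset => u; rewrite inE => /eqP; apply: xy.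
  rewrite /g pxy; congr andb; apply: eq_forallb => u.
  by case: eqP => //= bu; rewrite xy.
have gE x : [forall i, g i x] = (block_injective b x && canonical_tuple b x0 x)
    && [forall i, part b x i \in S i].
  apply/forallP/andP => [gx|[/andP[_ /eqP can] /forallP xS] i].
    have xS i : part b x i \in S i by have /andP[] := gx i.
    split; last by apply/forallP.
    apply/andP; split.
      apply/forallP => i; rewrite cb.
      by have /subsetP/(_ _ (xS i)) := Sc i; rewrite inE.
    apply/eqP/ffunP => u; rewrite !ffunE.
    by have /andP[_ /forallP/(_ u)] := gx (b u); rewrite eqxx /= => /eqP.
  rewrite /g xS; apply/forallP => u; apply/implyP => /eqP <-.
  by rewrite {1}can !ffunE.
rewrite family_deviationE; apply: le_trans (bounded g glocal).
rewrite le_eqVlt; apply/orP; left; apply/eqP; congr `| _ |.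
rewrite [RHS](bigID (fun x => block_injective b x && canonical_tuple b x0 x)) /=.
rewrite [X in _ + X]big1 ?addr0; last first.
  by move=> x /negbTE nx; rewrite gE nx /= mul0r.
rewrite sum_canonical [LHS](bigID (fun s : {ffun I -> {set V}} =>
  [forall i, #|s i| == #|block b i|])) /=.
rewrite [X in _ + X]big1 ?addr0; last first.
  move=> s ns; rewrite (_ : [forall i, _] = false) ?mul0r //.
  apply: contraNF ns => /forallP sS; apply/forallP => i; rewrite cb.
  by have /subsetP/(_ _ (sS i)) := Sc i; rewrite inE.
apply: eq_bigr => s /forallP cs.
have parts := part_assemble x0 (fun i => eqP (cs i)).
have -> : [forall i, g i (assemble b x0 s)] = [forall i, s i \in S i].
  rewrite gE; have -> : canonical_tuple b x0 (assemble b x0 s).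
    by apply/eqP; congr assemble; apply/ffunP => i; rewrite ffunE parts.
  have -> : block_injective b (assemble b x0 s).
    by apply/forallP => i; rewrite parts.
  by apply: eq_forallb => i; rewrite parts.
by rewrite (tuple_range_part b) (eq_bigr _ (fun i _ => parts i)).
Qed.

Lemma tuple_range_perm (P V : finType) (x : {ffun P -> V}) (s : {perm P}) :
  tuple_range [ffun u => x (s u)] = tuple_range x.
Proof.
apply/setP => v; apply/imsetP/imsetP => [[u _ ->]|[u _ ->]].
  by exists (s u); rewrite ?ffunE.
by exists (s^-1 u)%g; rewrite ?ffunE ?permKV.
Qed.

(** A hypothesis on families of sets controls canonical tuples only.  A tuple
    that is injective on each block is a reordered canonical one, so it is
    covered by at most [(#|P|)`!] applications of the hypothesis; the tuples with
    a repetition are few. *)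
Lemma tuple_of_set_bounded (R : realFieldType) (P V I : finType) (b : P -> I)
    (c : I -> nat) (E : {set {set V}}) (p M : R) :
  (0 < #|V|)%N -> (forall i, #|block b i| = c i) -> 0 <= p <= 1 ->
  set_bounded c E p M ->
  tuple_bounded b E p ((#|P|)`!%:R * M +
     #|[set x : {ffun P -> V} | ~~ injectiveb x]|%:R).
Proof.
move=> /card_gt0P[v0 _] cb p01 bounded g glocal.
pose x0 : {ffun P -> V} := [ffun => v0].
have M0 : 0 <= M.
  apply: le_trans (bounded (fun=> finset.set0) _) => [|i]; first exact: normr_ge0.
  exact: sub0set.
pose F x : R := [forall i, g i x]%:R * ((tuple_range x \in E)%:R - p).
have F1 x : `|F x| <= 1.
  rewrite /F ler_norml; case/andP: p01 => p0 p1.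
  by case: [forall i, _]; case: (_ \in E) => /=; apply/andP; split; lra.
rewrite (bigID (block_injective b)) /=.
apply: le_trans (ler_normD _ _) _; apply: lerD; last first.
  apply: le_trans (ler_norm_sum _ _ _) _.
  apply: le_trans (ler_sum _ (fun x _ => F1 x)) _.
  rewrite sumr_const ler_nat; apply: subset_leq_card; apply/subsetP => x.
  rewrite !inE; apply: contra => /injectiveP xi.
  by apply/block_injectiveP => u v _ /xi.
pose bperm (s : {perm P}) := [forall u, b (s u) == b u].
have -> : \sum_(x | block_injective b x) F x =
    \sum_(s | bperm s) \sum_(x | block_injective b x && canonical_tuple b x0 x)
       F [ffun u => x (s^-1 u)%g].
  transitivity (\sum_(x | block_injective b x) \sum_(s | bperm s)
      (canonical_tuple b x0 [ffun u => x (s u)])%:R * F x).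
    apply: eq_bigr => x xi; rewrite -mulr_suml.
    have [s0 s0P] := unique_reordering x0 xi.
    rewrite (bigID (fun s : {perm P} => canonical_tuple b x0 [ffun u => x (s u)])) /=.
    rewrite [X in _ + X]big1 ?addr0; last by move=> s /andP[_ /negbTE ->].
    rewrite (eq_bigl _ _ s0P) big_pred1_eq.
    by have := s0P s0; rewrite eqxx => /andP[_ ->]; rewrite mul1r.
  rewrite exchange_big /=; apply: eq_bigr => s /forallP bs.
  have bs' u : b (s u) = b u by apply/eqP.
  rewrite (reindex_onto (fun x : {ffun P -> V} => [ffun u => x (s^-1 u)%g])
     (fun x : {ffun P -> V} => [ffun u => x (s u)])) /=; last first.
    by move=> x _; apply/ffunP => u; rewrite !ffunE permKV.
  have backK (x : {ffun P -> V}) : [ffun u => [ffun v => x (s^-1 v)%g] (s u)] = x.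
    by apply/ffunP => u; rewrite !ffunE permK.
  rewrite big_mkcond /= [RHS]big_mkcond /=; apply: eq_bigr => x _.
  rewrite backK eqxx andbT.
  have -> : block_injective b [ffun u => x (s^-1 u)%g] = block_injective b x.
    by apply: eq_forallb => i; rewrite -(part_perm _ bs') backK.
  case: block_injective => //=.
  by case: canonical_tuple; rewrite ?mul1r ?mul0r.
apply: le_trans (ler_norm_sum _ _ _) _.
apply: (@le_trans _ _ (\sum_(s : {perm P} | bperm s) M)); last first.
  rewrite sumr_const -[M *+ _]mulr_natl ler_wpM2r // ler_nat.
  have /eq_card cT : [set: P] =i predT by move=> u; rewrite inE.
  rewrite -cT -card_perm; apply: subset_leq_card.
  by apply/subsetP => s _; rewrite unfold_in; apply/subsetP => u _; rewrite inE.
apply: ler_sum => s /forallP bs.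
have bs' u : b ((s^-1)%g u) = b u by rewrite -[in RHS](permKV s u) (eqP (bs _)).
pose S i := [set B : {set V} | (#|B| == c i) &&
   g i [ffun u => listing b x0 i B (s^-1 u)%g]].
have S_c i : S i \subset [set A : {set V} | #|A| == c i].
  by apply/subsetP => A; rewrite !inE => /andP[].
apply: le_trans (bounded S S_c).
rewrite le_eqVlt; apply/orP; left; apply/eqP; congr `| _ |.
rewrite family_deviationE sum_canonical.
rewrite [RHS](bigID (fun t : {ffun I -> {set V}} =>
  [forall i, #|t i| == #|block b i|])) /=.
rewrite [X in _ + X]big1 ?addr0; last first.
  move=> t nt; rewrite (_ : [forall i, _] = false) ?mul0r //.
  apply: contraNF nt => /forallP tS; apply/forallP => i.
  by have := tS i; rewrite inE cb => /andP[].
apply: eq_bigr => t /forallP ct.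
have parts := part_assemble x0 (fun i => eqP (ct i)).
rewrite /F tuple_range_perm (tuple_range_part b) (eq_bigr _ (fun i _ => parts i)).
congr (_%:R * _); congr nat_of_bool; apply: eq_forallb => i.
rewrite inE -cb ct /=; apply: glocal => u bu.
by rewrite !ffunE bs' bu.
Qed.

(** * A bilinear discrepancy estimate over a finite field *)

Lemma sqr_sum_le (R : realFieldType) (V : finType) (y : V -> R) :
  (\sum_c y c) ^+ 2 <= #|V|%:R * \sum_c y c ^+ 2.
Proof.
rewrite expr2 mulr_suml.
apply: (@le_trans _ _ (\sum_c \sum_d (y c ^+ 2 + y d ^+ 2) / 2)).
  apply: ler_sum => c _; rewrite mulr_sumr; apply: ler_sum => d _.
  by have := sqr_ge0 (y c - y d); rewrite sqrrB; lra.
rewrite (eq_bigr (fun c => #|V|%:R * y c ^+ 2 / 2 + (\sum_d y d ^+ 2) / 2)).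
  by rewrite big_split /= -!mulr_suml -mulr_sumr sumr_const -[_ *+ #|_|]mulr_natl; lra.
move=> c _; rewrite -mulr_suml big_split /= sumr_const -[_ *+ #|_|]mulr_natl.
by rewrite mulrDl.
Qed.

(** The difference of the two arguments determines [z.1] because [c != d], and
    either argument then determines [z.2]; so the pair of arguments runs over
    [F * F] exactly once. *)
Lemma pairwise_independent (R : realFieldType) (F : finFieldType)
    (phi : F -> R) (beta : F -> F) (c d e f : F) : c != d ->
  \sum_(z : F * F) phi (c * z.1 + e + beta z.1 + z.2)
                 * phi (d * z.1 + f + beta z.1 + z.2) = (\sum_y phi y) ^+ 2.
Proof.
move=> cd.
pose h (z : F * F) := (c * z.1 + e + beta z.1 + z.2, d * z.1 + f + beta z.1 + z.2).
have h_inj : injective h.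
  move=> [x y] [x' y'] /= [E1 E2].
  have Ex : (c - d) * (x - x') = 0.
    have -> : (c - d) * (x - x') = (c * x + e + beta x + y)
      - (d * x + f + beta x + y) - ((c * x' + e + beta x' + y')
      - (d * x' + f + beta x' + y')) by ring.
    by rewrite E1 E2 subrr.
  have xx : x = x'.
    by move/eqP: Ex; rewrite mulf_eq0 !subr_eq0 (negbTE cd) => /eqP.
  by rewrite -xx in E1 *; rewrite (addrI _ E1).
transitivity (\sum_(z : F * F) phi z.1 * phi z.2).
  by rewrite [RHS](reindex_inj h_inj).
by rewrite -(pair_big xpredT xpredT (fun x y => phi x * phi y)) /=
  expr2 mulr_suml; apply: eq_bigr => x _; rewrite mulr_sumr.
Qed.

(** Cauchy-Schwarz removes the test [W]; as no pair of labels is much more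
    frequent than the average, the sum over [w] may be replaced by a sum over
    all pairs of labels.  The remaining second moment is computed by pairwise
    independence, except for the few pairs of vertices that share their first
    label. *)
Lemma bilinear_discrepancy (R : realFieldType) (F : finFieldType) (V : finType)
    (l1 l2 : V -> F) (tau : F) (phi : F -> R) (alpha : V -> F) (beta : F -> F)
    (U W : V -> bool) :
  (forall z : F * F,
     (#|[set v | (l1 v, l2 v) == z]| * #|F| ^ 2 <= 2 * #|V|)%N) ->
  tau != 0 -> (forall y, `|phi y| <= 1) -> `|\sum_y phi y| <= 1 ->
  (\sum_v \sum_w (U v && W w)%:R *
      phi (tau * l1 v * l1 w + alpha v + beta (l1 w) + l2 w)) ^+ 2
    <= 6 * #|V|%:R ^+ 4 / #|F|%:R.
Proof.
move=> fibre tau0 phi1 sumphi.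
set n : R := #|V|%:R; set q : R := #|F|%:R.
have q1 : 1 <= q by rewrite ler1n; apply/card_gt0P; exists 0.
have n0 : 0 <= n by rewrite ler0n.
have q0 : 0 < q by lra.
have q2 : 0 < q ^+ 2 by rewrite exprn_gt0.
(* The final constant 6 is the factor 2 of the fibre bound kappa times the 3 of
   the second moment: 1 from independent pairs, 2 from equal first labels. *)
pose kappa := 2 * n / q ^+ 2.
have kappa0 : 0 <= kappa by rewrite divr_ge0 ?mulr_ge0 // ltW.
have fibreR z : #|[set v | (l1 v, l2 v) == z]|%:R <= kappa :> R.
  by rewrite ler_pdivlMr // -natrX -!natrM ler_nat.
have phiM y y' : phi y * phi y' <= 1.
  apply: le_trans (ler_norm _) _; rewrite normrM.
  by apply: mulr_ile1; rewrite ?normr_ge0 ?phi1.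
pose h v (z : F * F) := (tau * l1 v) * z.1 + alpha v + beta z.1 + z.2.
pose T z := \sum_v (U v)%:R * phi (h v z).
have secmom : \sum_z T z ^+ 2 <= 3 * n ^+ 2 * q.
  have -> : \sum_z T z ^+ 2 = \sum_v \sum_w (U v && U w)%:R *
      \sum_z phi (h v z) * phi (h w z).
    transitivity (\sum_z \sum_v \sum_w (U v && U w)%:R * (phi (h v z) * phi (h w z))).
      apply: eq_bigr => z _; rewrite expr2 mulr_suml; apply: eq_bigr => v _.
      rewrite mulr_sumr; apply: eq_bigr => w _.
      by case: (U v); case: (U w); rewrite ?(mul1r, mul0r, mulr0).
    rewrite exchange_big /=; apply: eq_bigr => v _.
    rewrite exchange_big /=; apply: eq_bigr => w _.
    by rewrite mulr_sumr.
  have term v w : (U v && U w)%:R * (\sum_z phi (h v z) * phi (h w z))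
      <= 1 + (l1 v == l1 w)%:R * q ^+ 2.
    case: (U v && U w); last by rewrite mul0r addr_ge0 // mulr_ge0 // ltW.
    rewrite mul1r; case: eqP => [_|/eqP vw].
      rewrite mul1r; apply: (@le_trans _ _ (\sum_(z : F * F) 1)).
        by apply: ler_sum => z _; apply: phiM.
      by rewrite sumr_const card_prod natrM -expr2 lerDr.
    have slopes : tau * l1 v != tau * l1 w by rewrite (inj_eq (mulfI tau0)).
    have -> : \sum_z phi (h v z) * phi (h w z) = (\sum_y phi y) ^+ 2 :=
      pairwise_independent phi beta (alpha v) (alpha w) slopes.
    by rewrite mul0r addr0 -real_normK ?num_real // expr_le1.
  apply: (@le_trans _ _ (\sum_v \sum_w (1 + (l1 v == l1 w)%:R * q ^+ 2))).
    by apply: ler_sum => v _; apply: ler_sum => w _; apply: term.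
  apply: (@le_trans _ _ (\sum_(v : V) (n + (q * kappa) * q ^+ 2))).
    apply: ler_sum => v _; rewrite big_split /= sumr_const -/n lerD2l.
    rewrite -mulr_suml ler_wpM2r ?(ltW q2) //.
    apply: (@le_trans _ _ (\sum_(y : F) kappa)); last first.
      by rewrite sumr_const -mulr_natl.
    rewrite (eq_bigr (fun w => \sum_(y : F) ((l1 w, l2 w) == (l1 v, y))%:R : R)).
      rewrite exchange_big /=; apply: ler_sum => y _.
      apply: le_trans (fibreR (l1 v, y)).
      rewrite -sum1_card natr_sum [X in _ <= X]big_mkcond /=.
      by apply: ler_sum => w _; rewrite inE; case: eqP.
    move=> w _; rewrite (bigD1 (l2 w)) //= xpair_eqE eqxx andbT eq_sym.
    rewrite big1 ?addr0 // => y /negbTE yw.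
    by rewrite xpair_eqE [l2 w == y]eq_sym yw andbF.
  rewrite sumr_const -[_ *+ _]mulr_natl -/n.
  have -> : q * kappa * q ^+ 2 = 2 * n * q.
    by rewrite /kappa; field; rewrite gt_eqF.
  have : n ^+ 2 <= n ^+ 2 * q by rewrite ler_peMr // sqr_ge0.
  by rewrite expr2; lra.
have -> : \sum_v \sum_w (U v && W w)%:R *
      phi (tau * l1 v * l1 w + alpha v + beta (l1 w) + l2 w)
    = \sum_w (W w)%:R * T (l1 w, l2 w).
  rewrite exchange_big /=; apply: eq_bigr => w _; rewrite mulr_sumr.
  by apply: eq_bigr => v _; rewrite -mulnb mulnC natrM mulrA.
apply: le_trans (sqr_sum_le _) _; rewrite -/n.
have -> : 6 * n ^+ 4 / q = n * (kappa * (3 * n ^+ 2 * q)).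
  by rewrite /kappa; field; rewrite gt_eqF.
apply: ler_wpM2l => //.
apply: (@le_trans _ _ (\sum_z #|[set v | (l1 v, l2 v) == z]|%:R * T z ^+ 2)).
  rewrite (eq_bigr (fun z => \sum_(w | (l1 w, l2 w) == z) T z ^+ 2)); last first.
    by move=> z _; rewrite sumr_const -[RHS]mulr_natl; congr (_%:R * _);
       apply: eq_card => w; rewrite !inE.
  rewrite (exchange_big_dep xpredT) //=; apply: ler_sum => w _.
  rewrite (big_pred1 (l1 w, l2 w)).
    by case: (W w); rewrite ?mul1r ?mul0r ?expr0n ?sqr_ge0.
  by move=> z; rewrite eq_sym.
apply: (@le_trans _ _ (\sum_z kappa * T z ^+ 2)).
  by apply: ler_sum => z _; apply: ler_wpM2r; rewrite ?sqr_ge0.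
by rewrite -mulr_sumr ler_wpM2l.
Qed.

(** * Hypergraphs defined by quadratic forms *)

Definition quadratic (F : finFieldType) (V J : finType) (l1 l2 : V -> F)
    (kap : V -> J) (A : {set V}) : F :=
  \sum_j (\sum_(v in A | kap v == j) l1 v) ^+ 2 + \sum_(v in A) l2 v.

(** The [k]-sets on which the colour classes are used as groups; [grouping]
    merges everything into one group elsewhere, since a [k]-set with other class
    sizes could have every class inside a block. *)
Definition balanced (V J : finType) (m : J -> nat) (col : V -> J) (A : {set V}) :=
  [forall j, #|[set v in A | col v == j]| == m j].

Definition grouping (V J : finType) (m : J -> nat) (col : V -> J) (j0 : J)
    (A : {set V}) : V -> J :=
  fun v => if balanced m col A then col v else j0.

Definition quadratic_edges (F : finFieldType) (V J : finType) (k : nat)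
    (m : J -> nat) (l1 l2 : V -> F) (col : V -> J) (j0 : J) (K : {set F}) :
    {set {set V}} :=
  [set A : {set V} | (#|A| == k) &&
     (quadratic l1 l2 (grouping m col j0 A) A \in K)].

Lemma quadratic_tuple_range (F : finFieldType) (P V J : finType) (m : J -> nat)
    (l1 l2 : V -> F) (col : V -> J) (j0 : J) (x : {ffun P -> V}) :
  injective x ->
  quadratic l1 l2 (grouping m col j0 (tuple_range x)) (tuple_range x) =
  quadratic (fun u => l1 (x u)) (fun u => l2 (x u))
    (grouping m [ffun u => col (x u)] j0 [set: P]) [set: P].
Proof.
move=> xi.
have bal : balanced m col (tuple_range x) = balanced m [ffun u => col (x u)] [set: P].
  apply: eq_forallb => j; congr (_ == _).
  rewrite -(card_imset [set u in [set: P] | [ffun u => col (x u)] u == j] xi).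
  apply: eq_card => v; rewrite inE; apply/andP/imsetP.
    by case=> /imsetP[u _ ->] cj; exists u => //; rewrite !inE ffunE.
  by case=> u; rewrite !inE ffunE => cj ->; split => //; apply/imsetP; exists u.
have gr u : grouping m col j0 (tuple_range x) (x u) =
    grouping m [ffun u => col (x u)] j0 [set: P] u.
  by rewrite /grouping bal ffunE.
have xi2 : {in [set: P] &, injective x} by move=> u v _ _; apply: xi.
rewrite /quadratic; congr (_ + _); last by rewrite big_imset.
apply: eq_bigr => j _; congr (_ ^+ 2).
rewrite big_mkcondr big_imset //= [RHS]big_mkcondr.
by apply: eq_bigr => u _; rewrite gr.
Qed.

(** Two positions of one group enter the quadratic form through the product of
    their labels; everything else depends on one of them at a time. *)
Lemma quadratic_update (F : finFieldType) (P V J : finType) (l1 l2 : V -> F)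
    (kap : P -> J) (x : {ffun P -> V}) (u v : P) : u != v -> kap u = kap v ->
  exists (alpha : V -> F) (beta : F -> F), forall a c,
  let y := update (update x u a) v c in
  quadratic (fun w => l1 (y w)) (fun w => l2 (y w)) kap [set: P] =
    2%:R * l1 a * l1 c + alpha a + beta (l1 c) + l2 c.
Proof.
move=> uv kuv.
pose rest j := \sum_(w | (kap w == j) && (w != u) && (w != v)) l1 (x w).
pose others := \sum_(j | j != kap v) rest j ^+ 2.
pose L := \sum_(w | (w != u) && (w != v)) l2 (x w).
(* Expanding the square of the group that contains both positions. *)
exists (fun a => (l1 a + rest (kap v)) ^+ 2 + others + l2 a + L).
exists (fun t => t ^+ 2 + 2%:R * rest (kap v) * t) => a c y.
have yu : y u = a by rewrite !ffunE (negbTE uv) eqxx.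
have yv : y v = c by rewrite !ffunE eqxx.
have yw w : (w != u) && (w != v) -> y w = x w.
  by case/andP=> /negbTE wu /negbTE wv; rewrite !ffunE wu wv.
rewrite /quadratic (bigD1 (kap v)) //=.
have -> : \sum_(w in [set: P]) l2 (y w) = l2 a + (l2 c + L).
  rewrite (bigD1 u) ?inE //= yu (bigD1 v) ?inE ?(eq_sym v) //= yv.
  congr (_ + (_ + _)); apply: eq_big => [w|w]; first by rewrite inE.
  by rewrite inE => /yw ->.
have -> : \sum_(w in [set: P] | kap w == kap v) l1 (y w)
    = l1 a + (l1 c + rest (kap v)).
  rewrite (bigD1 u) ?inE ?kuv //= yu (bigD1 v) ?inE ?eqxx ?(eq_sym v) //= yv.
  congr (_ + (_ + _)); apply: eq_big => [w|w]; first by rewrite inE.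
  by rewrite inE -andbA => /andP[_ /yw ->].
have -> : \sum_(j | j != kap v) (\sum_(w in [set: P] | kap w == j) l1 (y w)) ^+ 2
    = others.
  apply: eq_bigr => j jv; congr (_ ^+ 2); apply: eq_big => [w|w].
    rewrite inE /=; case: (kap w =P j) => //= wj; symmetry; apply/andP.
    by split; apply: contraNneq jv => wE; rewrite -wj wE ?kuv.
  rewrite inE /= => /eqP wj; rewrite yw //.
  by apply/andP; split; apply: contraNneq jv => wE; rewrite -wj wE ?kuv.
by ring.
Qed.

(** When some group meets two different blocks, fix all vertices but one from
    each of these blocks: every test on a block then sees at most one of the two
    free vertices, and the bilinear estimate applies. *)
Lemma pattern_discrepancy (R : realFieldType) (F : finFieldType)
    (P V I J : finType) (b : P -> I) (l1 l2 : V -> F) (col : V -> J)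
    (chi : P -> J) (kap : P -> J) (u v : P) (phi : F -> R) (delta : R)
    (g : I -> {ffun P -> V} -> bool) :
  (0 < #|V|)%N ->
  (forall z : F * F,
     (#|[set v | (l1 v, l2 v) == z]| * #|F| ^ 2 <= 2 * #|V|)%N) ->
  2%:R != 0 :> F -> (forall y, `|phi y| <= 1) -> `|\sum_y phi y| <= 1 ->
  0 <= delta -> 6 <= delta ^+ 2 * #|F|%:R ->
  kap u = kap v -> b u != b v -> block_local b g ->
  `|\sum_(x : {ffun P -> V}) ([forall w, col (x w) == chi w] && [forall i, g i x])%:R
      * phi (quadratic (fun w => l1 (x w)) (fun w => l2 (x w)) kap [set: P])|
    <= delta * #|V|%:R ^+ #|P|.
Proof.
move=> V0 fibre two0 phi1 sumphi delta0 deltaq kuv buv glocal.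
pose H (x : {ffun P -> V}) : R :=
  ([forall w, col (x w) == chi w] && [forall i, g i x])%:R
   * phi (quadratic (fun w => l1 (x w)) (fun w => l2 (x w)) kap [set: P]).
rewrite -[X in `|X|]/(\sum_x H x).
have uv : u != v by apply: contraNneq buv => ->.
have n0 : 0 < #|V|%:R :> R by rewrite ltr0n.
have q0 : 0 < #|F|%:R :> R by rewrite ltr0n; apply/card_gt0P; exists 0.
have slice x : `|\sum_a \sum_c H (update (update x u a) v c)|
    <= delta * #|V|%:R ^+ 2.
  have [alpha [beta quadE]] := quadratic_update l1 l2 x uv kuv.
  pose U a := [forall w, (w != v) ==> (col (update x u a w) == chi w)] &&
     [forall i, (i != b v) ==> g i (update x u a)].
  pose W c := (col c == chi v) && g (b v) (update x v c).
  rewrite (eq_bigr (fun a => \sum_c (U a && W c)%:R *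
      phi (2%:R * l1 a * l1 c + alpha a + beta (l1 c) + l2 c))).
    have bound0 : 0 <= delta * #|V|%:R ^+ 2 by rewrite mulr_ge0 ?sqr_ge0.
    rewrite -ler_sqr ?nnegrE // real_normK ?num_real //.
    apply: le_trans (bilinear_discrepancy _ _ _ _ fibre two0 phi1 sumphi) _.
    rewrite exprMn -exprM ler_pdivrMr // mulrAC.
    by apply: ler_wpM2r => //; apply: exprn_ge0; apply: ltW.
  move=> a _; apply: eq_bigr => c _; rewrite /H quadE; congr (_%:R * _).
  congr nat_of_bool; set y := update _ v c.
  have gv : g (b v) y = g (b v) (update x v c).
    apply: glocal => w bw; rewrite !ffunE; case: eqP => // _.
    by case: eqP => // wu; rewrite -wu bw eqxx in buv.
  have gi i : i != b v -> g i y = g i (update x u a).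
    move=> iv; apply: glocal => w bw; rewrite ffunE.
    by case: eqP => // wv; rewrite -bw wv eqxx in iv.
  have yv : y v = c by rewrite ffunE eqxx.
  have yw w : w != v -> y w = update x u a w by rewrite [y w]ffunE => /negbTE ->.
  apply/andP/andP.
    case=> /forallP cy /forallP gy; split; apply/andP; split.
    - by apply/forallP => w; apply/implyP => wv; rewrite -yw.
    - by apply/forallP => i; apply/implyP => iv; rewrite -gi.
    - by rewrite -yv.
    - by rewrite -gv.
  case=> /andP[/forallP cU /forallP gU] /andP[cW gW]; split; apply/forallP.
    move=> w; have [->|wv] := eqVneq w v; first by rewrite yv.
    by rewrite yw //; apply: (implyP (cU w)).
  move=> i; have [->|iv] := eqVneq i (b v); first by rewrite gv.
  by rewrite gi //; apply: (implyP (gU i)).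
have E : (\sum_x \sum_a \sum_c H (update (update x u a) v c)) =
    (\sum_x H x) * #|V|%:R ^+ 2.
  rewrite (sum_update u (fun x => \sum_c H (update x v c))) sum_update.
  by rewrite -mulrnA mulnn -natrX mulr_natr.
have n2 : 0 < #|V|%:R ^+ 2 :> R by rewrite exprn_gt0.
rewrite -(ler_pM2r n2) -[in X in X <= _](ger0_norm (ltW n2)) -normrM -E.
apply: le_trans (ler_norm_sum _ _ _) _.
apply: le_trans (ler_sum _ (fun x _ => slice x)) _.
by rewrite sumr_const card_ffun -[X in X <= _]mulr_natl natrX mulrCA mulrA.
Qed.

(** The colour pattern of a tuple decides which quadratic form applies, so the
    patterns are treated one at a time. *)
Lemma quadratic_tuple_bounded (R : realFieldType) (F : finFieldType)
    (P V I J : finType) (b : P -> I) (m : J -> nat) (l1 l2 : V -> F)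
    (col : V -> J) (j0 : J) (K : {set F}) (p delta : R) :
  (0 < #|V|)%N ->
  (forall z : F * F,
     (#|[set v | (l1 v, l2 v) == z]| * #|F| ^ 2 <= 2 * #|V|)%N) ->
  2%:R != 0 :> F -> 0 <= p <= 1 -> `|#|K|%:R - p * #|F|%:R| <= 1 ->
  0 <= delta -> 6 <= delta ^+ 2 * #|F|%:R ->
  (forall chi : {ffun P -> J}, exists u v,
     grouping m chi j0 [set: P] u = grouping m chi j0 [set: P] v /\ b u != b v) ->
  tuple_bounded b (quadratic_edges #|P| m l1 l2 col j0 K) p
    (#|J|%:R ^+ #|P| * (delta * #|V|%:R ^+ #|P|) +
     #|[set x : {ffun P -> V} | ~~ injectiveb x]|%:R).
Proof.
move=> V0 fibre two0 p01 cardK delta0 deltaq crossing g glocal.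
set E := quadratic_edges _ _ _ _ _ _ _.
pose phi y : R := (y \in K)%:R - p.
have phi1 y : `|phi y| <= 1.
  rewrite /phi ler_norml; case/andP: p01 => p0 p1.
  by case: (y \in K) => /=; apply/andP; split; lra.
have sumphi : `|\sum_y phi y| <= 1.
  rewrite /phi sumrB sumr_const -[p *+ _]mulr_natr.
  suff -> : \sum_y (y \in K)%:R = #|K|%:R :> R by [].
  by rewrite -sum1_card natr_sum [RHS]big_mkcond; apply: eq_bigr => y _; case: ifP.
(* On injective tuples the edge condition is the tuple condition; the others
   are absorbed in the error. *)
pose Q (x : {ffun P -> V}) (chi : {ffun P -> J}) :=
  quadratic (fun u => l1 (x u)) (fun u => l2 (x u))
    (grouping m chi j0 [set: P]) [set: P].
pose chi_ (x : {ffun P -> V}) : {ffun P -> J} := [ffun u => col (x u)].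
rewrite (eq_bigr (fun x : {ffun P -> V} => [forall i, g i x]%:R * phi (Q x (chi_ x)) +
  [forall i, g i x]%:R * ((tuple_range x \in E)%:R - (Q x (chi_ x) \in K)%:R))); last first.
  by move=> x _; rewrite -mulrDr /phi; congr (_ * _); ring.
rewrite big_split /=; apply: le_trans (ler_normD _ _) _; apply: lerD.
  rewrite (eq_bigr (fun x : {ffun P -> V} => \sum_(chi : {ffun P -> J})
      ([forall w, col (x w) == chi w] && [forall i, g i x])%:R * phi (Q x chi))).
    rewrite exchange_big /=; apply: le_trans (ler_norm_sum _ _ _) _.
    rewrite -natrX -card_ffun mulr_natl -sumr_const; apply: ler_sum => chi _.
    have [u [v [kuv buv]]] := crossing chi.
    exact: pattern_discrepancy deltaq kuv buv glocal.
  move=> x _; rewrite (bigD1 (chi_ x)) //= big1 ?addr0 => [|chi chix].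
    by have -> : [forall w, col (x w) == chi_ x w];
      first by apply/forallP => w; rewrite ffunE.
  rewrite (_ : [forall w, col (x w) == chi w] = false) ?mul0r //.
  apply: contraNF chix.
  by move=> /forallP cx; apply/eqP/ffunP => w; rewrite ffunE (eqP (cx w)).
apply: le_trans (ler_norm_sum _ _ _) _.
rewrite -sum1_card natr_sum [X in _ <= X]big_mkcond /=; apply: ler_sum => x _.
rewrite [x \in _]inE; case: (injectiveP x) => /= [xi|_].
  have -> : Q x (chi_ x) = quadratic l1 l2 (grouping m col j0 (tuple_range x)) (tuple_range x).
    by rewrite quadratic_tuple_range.
  rewrite inE card_imset // cardsT eqxx /=.
  by rewrite subrr mulr0 normr0.
rewrite ler_norml; apply/andP.
by case: [forall i, _]; case: (_ \in E); case: (_ \in K) => /=; split; lra.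
Qed.

(** * Non-refinement and planted families *)

(** If no group of some colouring met two blocks, sending each colour to the
    block that contains its class would exhibit a refinement. *)
Lemma crossing_pair (P I J : finType) (b : P -> I) (c : I -> nat) (m : J -> nat)
    (j0 : J) :
  (forall i, #|block b i| = c i) -> (forall i, (0 < c i)%N) ->
  (forall j, (0 < m j)%N) -> (1 < #|I|)%N ->
  ~ (exists phi : J -> I, forall i, c i = (\sum_(j | phi j == i) m j)%N) ->
  forall chi : P -> J, exists u v,
    grouping m chi j0 [set: P] u = grouping m chi j0 [set: P] v /\ b u != b v.
Proof.
move=> cb c0 m0 /card_gt1P[i1 [i2 [_ _ i12]]] norefine chi.
have [/existsP[u /existsP[v /andP[/eqP kuv buv]]]|] := boolP [exists u, exists v,
  (grouping m chi j0 [set: P] u == grouping m chi j0 [set: P] v) && (b u != b v)].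
  by exists u, v.
move=> nocross; case: norefine.
have const u v : grouping m chi j0 [set: P] u = grouping m chi j0 [set: P] v ->
    b u = b v.
  move=> kuv; apply/eqP/negPn; apply: contra nocross => buv.
  by apply/existsP; exists u; apply/existsP; exists v; rewrite kuv eqxx.
have block_elt i : exists u, b u = i.
  have /card_gt0P[u] : (0 < #|block b i|)%N by rewrite cb.
  by rewrite inE => /eqP; exists u.
have [bal|nbal] := boolP (balanced m chi [set: P]); last first.
  have [u1 bu1] := block_elt i1; have [u2 bu2] := block_elt i2.
  move: i12; rewrite -bu1 -bu2 (const u1 u2) ?eqxx //.
  by rewrite /grouping (negbTE nbal).
have cardm j : #|[set u in [set: P] | chi u == j]| = m j by apply/eqP/(forallP bal).
have class_elt j : exists u, chi u == j.
  have /card_gt0P[u] : (0 < #|[set u in [set: P] | chi u == j]|)%N by rewrite cardm.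
  by rewrite inE => /andP[_]; exists u.
pose phi j := b (xchoose (class_elt j)).
have phiE u : phi (chi u) = b u.
  apply: const; rewrite /grouping bal.
  exact/eqP/(xchooseP (class_elt (chi u))).
exists phi => i; rewrite -cb -sum1_card.
rewrite (partition_big chi (fun j => phi j == i)) /= => [|u]; last first.
  by rewrite inE phiE.
apply: eq_bigr => j /eqP <-; rewrite -cardm -sum1_card; apply: eq_bigl => u.
rewrite !inE; case: (chi u =P j) => [<-|]; last by rewrite andbF.
by rewrite phiE eqxx.
Qed.

Lemma val_sum_Fp (q : nat) (J : finType) (z : J -> 'F_q) :
  (((\sum_j z j)%R : 'F_q) <= \sum_j (z j : nat))%N.
Proof.
elim/big_rec2: _ => [|j y x _ yx] //=.
by apply: leq_trans (leq_mod _ _) _; rewrite leq_add2l.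
Qed.

Lemma card_initial_segment (q N : nat) : prime q -> (N <= q)%N ->
  #|[set z : 'F_q | ((z : nat) < N)%N]| = N.
Proof.
move=> pq; rewrite -[X in (N <= X)%N](Fp_cast pq) => Nq.
rewrite -sum1_card.
rewrite (eq_bigl (fun z : 'F_q => ((z : nat) < N)%N)) => [|z]; last by rewrite inE.
rewrite -(big_ord_widen _ (fun=> 1%N) Nq).
by rewrite sum1_card card_ord.
Qed.

(** On average over the translations of [L], a proportion [#|L| / #|F|] of the
    values of [G] falls into the translate, and some translation attains the
    average. *)
Lemma exists_translate (F : finFieldType) (T : finType) (C : {set T})
    (G : T -> F) (L : {set F}) :
  exists s, (#|L| * #|C| <= #|F| * #|[set x in C | (G x - s)%R \in L]|)%N.
Proof.
pose cnt s := #|[set x in C | (G x - s)%R \in L]|.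
have tot : (\sum_s cnt s = #|C| * #|L|)%N.
  rewrite (eq_bigr (fun s => \sum_(x in C) ((G x - s)%R \in L))%N); last first.
    move=> s _; rewrite /cnt -sum1_card (eq_bigl (fun x => (x \in C) && (G x - s \in L))).
      by rewrite big_mkcondr; apply: eq_bigr => x _; case: ifP.
    by move=> x; rewrite inE.
  rewrite exchange_big /= -sum_nat_const; apply: eq_bigr => x _.
  rewrite -sum1_card [RHS]big_mkcond /=.
  rewrite (reindex_inj (can_inj (subKr (G x)))) /=.
  by apply: eq_bigr => s _; rewrite opprB addrC subrK; case: ifP.
have [s _ smax] := @arg_maxnP _ (0 : F) xpredT cnt isT.
exists s; rewrite mulnC -tot -/(cnt s) -sum_nat_const.
by apply: leq_sum => s' _; apply: smax.
Qed.

(** Inside one colour class per index, sets whose quadratic values lie in short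
    intervals only form edges: the values add up inside an interval of length
    [N].  The translations let an averaging argument replace any count of the
    values of the form. *)
Lemma planted_family (q N k : nat) (V J : finType) (m : J -> nat)
    (l1 l2 : V -> 'F_q) (col : V -> J) (j0 : J) :
  prime q -> (N <= q)%N -> (\sum_j m j = k)%N ->
  exists (K : {set 'F_q}) (S : J -> {set {set V}}),
  [/\ #|K| = N, forall j, S j \subset [set A : {set V} | #|A| == m j],
      forall j, (N %/ #|J| * 'C(#|[set v | col v == j]|, m j) <= q * #|S j|)%N
    & forall s : {ffun J -> {set V}}, (forall j, s j \in S j) ->
      \bigcup_j s j \in quadratic_edges k m l1 l2 col j0 K].
Proof.
move=> pq Nq summ.
pose L := [set z : 'F_q | ((z : nat) < N %/ #|J|)%N].
pose G (A : {set V}) := (\sum_(v in A) l1 v) ^+ 2 + \sum_(v in A) l2 v.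
pose C j := [set A : {set V} | (A \subset [set v | col v == j]) && (#|A| == m j)].
have J0 : (0 < #|J|)%N by apply/card_gt0P; exists j0.
have [t tP] : exists t : J -> 'F_q, forall j,
    (#|L| * #|C j| <= #|'F_q| * #|[set A in C j | (G A - t j)%R \in L]|)%N.
  exact: (fin_all_exists (fun j => exists_translate (C j) G L)).
(* The translations t of the families have to be undone in K. *)
exists [set y : 'F_q | (((y - \sum_j t j)%R : 'F_q) < N)%N].
exists (fun j => [set A in C j | G A - t j \in L]); split.
- rewrite -[RHS](card_initial_segment pq Nq).
  rewrite -[RHS](card_imset _ (addIr (\sum_j t j))).
  apply: eq_card => y; rewrite inE; apply/idP/imsetP => [yN|[z]].
    by exists (y - \sum_j t j); rewrite ?inE ?subrK.
  by rewrite inE => zN ->; rewrite addrK.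
- by move=> j; apply/subsetP => A; rewrite !inE => /andP[/andP[]].
- move=> j; have := tP j; rewrite card_Fp // card_initial_segment //; last first.
    exact: leq_trans (leq_div _ _) Nq.
  by rewrite cards_draws.
move=> s sS; set A := \bigcup_j s j.
have sC j : s j \in C j by have := sS j; rewrite inE => /andP[].
have sub j v : v \in s j -> col v = j.
  have := sC j; rewrite inE => /andP[/subsetP sj _] /sj.
  by rewrite inE => /eqP.
have Aj j : [set v in A | col v == j] = s j.
  apply/setP => v; rewrite inE; apply/andP/idP => [[/bigcupP[i _ vi] /eqP <-]|vj].
    by rewrite (sub _ _ vi).
  by split; [apply/bigcupP; exists j|rewrite (sub _ _ vj)].
have bal : balanced m col A.
  by apply/forallP => j; rewrite Aj; have := sC j; rewrite inE => /andP[].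
rewrite inE; apply/andP; split.
  rewrite -summ -sum1_card (partition_big col xpredT) //=.
  apply/eqP/eq_bigr => j _; rewrite -(eqP (forallP bal j)) -sum1_card.
  by apply: eq_bigl => v; rewrite !inE.
have -> : quadratic l1 l2 (grouping m col j0 A) A = \sum_j G (s j).
  rewrite /quadratic /G big_split /=; congr (_ + _).
    apply: eq_bigr => j _; congr (_ ^+ 2); apply: eq_bigl => v.
    by rewrite -[in RHS]Aj inE /grouping bal.
  rewrite (partition_big col xpredT) //=; apply: eq_bigr => j _.
  by apply: eq_bigl => v; rewrite -[in RHS]Aj inE.
rewrite inE -sumrB; apply: leq_ltn_trans (val_sum_Fp _) _.
apply: (@leq_trans (\sum_(j : J) N %/ #|J|)); last first.
  by rewrite sum_nat_const mulnC leq_divM.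
apply: (@leq_trans (\sum_(j : J) (((G (s j) - t j)%R : 'F_q) : nat).+1)); last first.
  by apply: leq_sum => j _; have := sS j; rewrite inE => /andP[_]; rewrite inE.
have -> (x : J -> nat) : (\sum_j (x j).+1 = #|J| + \sum_j x j)%N.
  by rewrite -sum1_card -big_split.
by rewrite -add1n leq_add2r.
Qed.

(** * The construction on [n] vertices *)

(** The labels of [v] are its two lowest digits in base [q], hence determine
    [v] modulo [q ^ 2]. *)
Lemma label_fibre (n q : nat) (z : 'F_q * 'F_q) : prime q -> (q ^ 2 <= n)%N ->
  (#|[set v : 'I_n | ((v : nat)%:R, (v %/ q)%:R) == z]| * #|'F_q| ^ 2
     <= 2 * #|'I_n|)%N.
Proof.
move=> pq qn; rewrite card_Fp // card_ord.
have q2 : (0 < q ^ 2)%N by rewrite expn_gt0 prime_gt0.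
set D := [set v : 'I_n | _].
suff cD : (#|D| <= (n %/ q ^ 2).+1)%N.
  apply: leq_trans (leq_mul cD (leqnn _)) _.
  by rewrite mulSn mul2n -addnn; apply: leq_add; rewrite ?leq_divM.
have bound (v : 'I_n) : (v %/ q ^ 2 < (n %/ q ^ 2).+1)%N.
  by rewrite ltnS leq_div2r // ltnW.
rewrite -[X in (_ <= X)%N]card_ord.
rewrite -(@card_in_imset _ _ (fun v : 'I_n => Ordinal (bound v)) (mem D)).
  exact: max_card.
move=> v w; rewrite !inE => /eqP vz; rewrite -{}vz => /eqP[e1 e2] [e3].
have nat_eq (a a' : nat) : a%:R = a'%:R :> 'F_q -> (a %% q = a' %% q)%N.
  by move=> /(congr1 (fun y : 'F_q => y : nat)); rewrite !val_Fp_nat.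
have e12 : (v %/ q = w %/ q)%N.
  rewrite (divn_eq (v %/ q) q) (divn_eq (w %/ q) q) -!divnMA mulnn e3.
  by rewrite (nat_eq _ _ (esym e2)).
apply: val_inj => /=.
by rewrite (divn_eq v q) (divn_eq w q) e12 (nat_eq _ _ (esym e1)).
Qed.

Lemma card_residue_class (n r : nat) (r0 : (0 < r)%N) (j : 'I_r) :
  (n %/ r <= #|[set v : 'I_n | Ordinal (ltn_pmod v r0) == j]|)%N.
Proof.
have lt_n (i : 'I_(n %/ r)) : (i * r + j < n)%N.
  have ir : (i.+1 * r <= n)%N.
    by apply: leq_trans (leq_divM n r); rewrite leq_mul2r ltn_ord orbT.
  by apply: leq_trans ir; rewrite mulSn addnC ltn_add2r.
rewrite -[X in (X <= _)%N]card_ord -(@card_imset _ _ (fun i => Ordinal (lt_n i))).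
  apply: subset_leq_card; apply/subsetP => v /imsetP[i _ ->].
  by rewrite inE -val_eqE /= modnMDl modn_small.
move=> i i' [] /eqP; rewrite eqn_add2r eqn_mul2r => /orP[/eqP r00|/eqP ii].
  by rewrite r00 in r0.
exact: val_inj.
Qed.

Lemma leq_expn_binomial (x m : nat) : ((x - m) ^ m <= 'C(x, m) * m`!)%N.
Proof.
rewrite bin_ffact; elim: m x => [|m IH] [|x] //; first by rewrite sub0n exp0n.
rewrite ffactnS subSS expnS leq_mul //.
by apply: leq_trans (leq_subr _ _) _.
Qed.

(** A lower bound for the relative size of a planted family: [p / (2 * r)] from
    the length of the interval, the rest from the number of [m]-subsets of a
    colour class. *)
Definition planted_density (R : realFieldType) (p : R) (r k : nat) : R :=
  p / (2 * r%:R) / ((2 * r%:R) ^+ k * k`!%:R).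

(** Rounding loses at most a factor of two in each of [N %/ r] and [n %/ r - m]
    when [q] and [n] are large. *)
Lemma planted_density_le (R : realFieldType) (p : R)
    (r k n m q N cls sz : nat) :
  (0 < r)%N -> (0 < q)%N -> 0 < p -> p * q%:R <= N%:R + 1 ->
  2 * (r%:R + 1) <= p * q%:R -> (2 * r * k.+1 <= n)%N -> (m <= k)%N ->
  (n %/ r <= cls)%N -> (N %/ r * 'C(cls, m) <= q * sz)%N ->
  planted_density p r k * n%:R ^+ m <= sz%:R.
Proof.
move=> r0 q0 p0 pqN rq kn mk ncls szP.
have rR : 0 < r%:R :> R by rewrite ltr0n.
have qR : 0 < q%:R :> R by rewrite ltr0n.
have r1 : 1 <= r%:R :> R by rewrite ler1n.
have step1 : p * q%:R / (2 * r%:R) <= (N %/ r)%:R.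
  rewrite ler_pdivrMr ?mulr_gt0 //.
  have : N%:R <= (N %/ r)%:R * r%:R + r%:R :> R.
    by rewrite -natrM -natrD ler_nat [X in (X <= _)%N](divn_eq N r)
      leq_add2l ltnW // ltn_pmod.
  lra.
have step2 : (n%:R / (2 * r%:R)) ^+ m <= 'C(cls, m)%:R * m`!%:R :> R.
  apply: (@le_trans _ _ ((cls - m) ^ m)%:R); last first.
    by rewrite -natrM ler_nat leq_expn_binomial.
  rewrite natrX lerXn2r ?nnegrE ?divr_ge0 ?mulr_ge0 //.
  rewrite ler_pdivrMr ?mulr_gt0 // -!natrM ler_nat.
  have nr : (n < (n %/ r).+1 * r)%N by rewrite -ltn_divLR.
  apply: (@leq_trans (((n %/ r) - k) * (2 * r))); last first.
    by rewrite leq_mul2r leq_sub ?orbT.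
  nia.
have step3 : m`!%:R <= k`!%:R :> R.
  rewrite ler_nat -(subnK mk); elim: (k - m)%N => // d IH.
  by rewrite addSn factS (leq_trans IH) // leq_pmull.
have step4 : (2 * r%:R) ^+ m <= (2 * r%:R) ^+ k :> R.
  by rewrite ler_weXn2l //; lra.
have m0 : 0 < m`!%:R :> R by rewrite ltr0n fact_gt0.
have k0 : 0 < k`!%:R :> R by rewrite ltr0n fact_gt0.
have rr : 0 < 2 * r%:R :> R by rewrite mulr_gt0.
have rm : 0 < (2 * r%:R) ^+ m :> R by rewrite exprn_gt0.
have rk : 0 < (2 * r%:R) ^+ k :> R by rewrite exprn_gt0.
have n0 : 0 <= n%:R ^+ m :> R by rewrite exprn_ge0.
have step5 : n%:R ^+ m / ((2 * r%:R) ^+ k * k`!%:R) <= 'C(cls, m)%:R :> R.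
  apply: (@le_trans _ _ (n%:R ^+ m / ((2 * r%:R) ^+ m * m`!%:R))).
    apply: ler_wpM2l => //; rewrite lef_pV2 ?posrE ?mulr_gt0 //.
    by apply: ler_pM => //; apply: ltW.
  by rewrite invfM mulrA ler_pdivrMr // -expr_div_n.
have : (N %/ r)%:R * 'C(cls, m)%:R <= q%:R * sz%:R :> R.
  by rewrite -!natrM ler_nat.
move=> szR; rewrite -(ler_pM2l qR); apply: le_trans szR.
apply: (@le_trans _ _ ((p * q%:R / (2 * r%:R)) *
  (n%:R ^+ m / ((2 * r%:R) ^+ k * k`!%:R)))).
  by rewrite /planted_density le_eqVlt; apply/orP; left; apply/eqP; ring.
apply: ler_pM => //; first by rewrite divr_ge0 ?mulr_ge0 // ltW.
Qed.

Lemma quadratic_construction (R : realType) (P I : finType) (b : P -> I)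
    (r : nat) (m : 'I_r -> nat) (j0 : 'I_r) (p : R) (n q : nat) :
  0 < p < 1 -> (\sum_j m j = #|P|)%N ->
  (forall chi : {ffun P -> 'I_r}, exists u v,
     grouping m chi j0 [set: P] u = grouping m chi j0 [set: P] v /\ b u != b v) ->
  prime q -> odd q -> (q ^ 2 <= n)%N ->
  exists (E : {set {set 'I_n}}) (S : 'I_r -> {set {set 'I_n}}),
  [/\ forall A, A \in E -> #|A| = #|P|,
      forall delta : R, 0 <= delta -> 6 <= delta ^+ 2 * q%:R ->
        tuple_bounded b E p (r%:R ^+ #|P| * (delta * n%:R ^+ #|P|) +
          #|[set x : {ffun P -> 'I_n} | ~~ injectiveb x]|%:R),
      forall j, S j \subset [set A : {set 'I_n} | #|A| == m j],
      forall s : {ffun 'I_r -> {set 'I_n}},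
        (forall j, s j \in S j) -> \bigcup_j s j \in E
    & 2 * (r%:R + 1) <= p * q%:R -> (2 * r * #|P|.+1 <= n)%N ->
      forall j, planted_density p r #|P| * n%:R ^+ m j <= #|S j|%:R].
Proof.
move=> /andP[p0 p1] summ crossing pq oddq qn.
have r0 : (0 < r)%N by apply: leq_trans (ltn_ord j0).
have q0 : 0 < q%:R :> R by rewrite ltr0n prime_gt0.
have pq0 : 0 <= p * q%:R by rewrite mulr_ge0 // ltW.
pose N := Num.truncn (p * q%:R).
have /andP[N1 N2] : N%:R <= p * q%:R < N.+1%:R by apply: truncn_itv.
have Nq : (N <= q)%N.
  rewrite -(@ler_nat R); apply: le_trans N1 _.
  by rewrite ler_piMl // ltW.
pose l1 (v : 'I_n) : 'F_q := (v : nat)%:R.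
pose l2 (v : 'I_n) : 'F_q := (v %/ q)%:R.
pose col (v : 'I_n) := Ordinal (ltn_pmod v r0).
have [K [S [cK Ssub Ssize SE]]] :=
  planted_family l1 l2 col j0 pq Nq summ.
exists (quadratic_edges #|P| m l1 l2 col j0 K), S; split => //.
- by move=> A; rewrite inE => /andP[/eqP].
- move=> delta delta0 deltaq.
  have n0 : (0 < #|'I_n|)%N.
    by rewrite card_ord (leq_trans _ qn) // expn_gt0 prime_gt0.
  have := @quadratic_tuple_bounded R 'F_q P 'I_n I 'I_r b m l1 l2 col j0 K p delta.
  rewrite card_Fp // !card_ord; apply => //.
  + by move: n0; rewrite card_ord.
  + by move=> z; have := label_fibre z pq qn; rewrite card_Fp // card_ord.
  + rewrite -(dvdn_pcharf (pchar_Fp pq)) gtnNdvd // ltn_neqAle prime_gt1 // andbT.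
    by apply: contraTneq oddq => <-.
  + by rewrite (ltW p0) (ltW p1).
  + rewrite cK ler_norml; apply/andP; move: N2; rewrite -natr1.
    by split; lra.
- move=> rq kn j.
  apply: (@planted_density_le R p r #|P| n (m j) q N
    #|[set v | col v == j]| #|S j|) => //.
  + exact: prime_gt0.
  + by move: N2; rewrite -natr1 => /ltW.
  + by rewrite -summ (bigD1 j) //= leq_addr.
  + exact: card_residue_class.
  by have := Ssize j; rewrite card_ord.
Qed.

(** * Asymptotics *)

(** The uniform error may be taken to be the largest deviation on [n] vertices,
    so only its eventual size matters. *)
Lemma ExpandP (R : realType) (p : R) (k : nat) (lam : seq nat)
    (H : nat -> uniform_hypergraph k) :
  Expand p lam H <->
  forall e : R, 0 < e -> exists N, forall n, (N <= n)%N ->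
    set_bounded (fun i : 'I_(size lam) => nth 0%N lam i) (edges (H n)) p
      (e * n%:R ^+ k).
Proof.
split=> [[f [f0 fH]] e e0|Heps].
  move/cvgrPdist_le: f0 => /(_ e e0) [N _ HN].
  exists N.+1 => n nN S Ssub; apply: le_trans (fH n S Ssub) _.
  have n0 : 0 < n%:R ^+ k :> R.
    by rewrite exprn_gt0 // ltr0n (leq_trans _ nN).
  have := HN n (ltnW nN); rewrite /= sub0r normrN normrM normfV (gtr0_norm n0).
  rewrite ler_pdivrMr //; apply: le_trans; exact: ler_norm.
pose ok n (S : {ffun 'I_(size lam) -> {set {set vertex (H n)}}}) :=
  [forall i, S i \subset ksubsets (vertex (H n)) (nth 0%N lam i)].
pose f n : R := \big[Num.max/0]_(S | @ok n S) `|family_deviation (edges (H n)) p S|.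
exists f; split; last first.
  move=> n S Ssub.
  have okS : @ok n [ffun i => S i] by apply/forallP => i; rewrite ffunE.
  have := le_bigmax_cond 0
    (fun S : {ffun 'I_(size lam) -> {set {set vertex (H n)}}} =>
       `|family_deviation (edges (H n)) p S|) okS.
  suff -> : family_deviation (edges (H n)) p [ffun i => S i] =
            family_deviation (edges (H n)) p S by [].
  by congr family_deviation; apply/funext => i; rewrite ffunE.
apply/cvgrPdist_le => e e0; have [N HN] := Heps e e0.
exists N => // n /= Nn; rewrite sub0r normrN normrM normfV.
have n0 : 0 <= n%:R ^+ k :> R by rewrite exprn_ge0.
have f0 : 0 <= f n by apply: bigmax_ge_id.
have fle : f n <= e * n%:R ^+ k.
  apply/bigmax_leP; split; first by rewrite mulr_ge0 // ltW.
  by move=> S /forallP okS; apply: HN.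
rewrite (ger0_norm f0) (ger0_norm n0).
move: n0; rewrite le_eqVlt => /orP[/eqP <-|n0].
  by rewrite invr0 mulr0 ltW.
by rewrite ler_pdivrMr.
Qed.

Lemma noninjective_le (R : realFieldType) (P V : finType) (e : R) :
  (0 < #|V|)%N -> #|P|%:R ^+ 2 <= e * #|V|%:R ->
  #|[set x : {ffun P -> V} | ~~ injectiveb x]|%:R <= e * #|V|%:R ^+ #|P|.
Proof.
move=> V0 Pe; have n0 : 0 < #|V|%:R :> R by rewrite ltr0n.
rewrite -(ler_pM2r n0) -natrM.
apply: le_trans (_ : (#|P| ^ 2 * #|V| ^ #|P|)%:R <= _).
  by rewrite ler_nat card_noninjective.
rewrite natrM !natrX [e * _ * _]mulrAC.
by apply: ler_wpM2r.
Qed.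

Lemma set_bounded_le (R : realFieldType) (V I : finType) (c : I -> nat)
    (E : {set {set V}}) (p M M' : R) :
  M <= M' -> set_bounded c E p M -> set_bounded c E p M'.
Proof. by move=> MM bounded S Sc; apply: le_trans (bounded S Sc) MM. Qed.

(** * Positions of a partition *)

Definition position (lam : seq nat) : finType :=
  {i : 'I_(size lam) & 'I_(nth 0%N lam i)}.

Lemma sumn_nth (lam : seq nat) : sumn lam = (\sum_(i < size lam) nth 0 lam i)%N.
Proof. by rewrite sumnE (big_nth 0%N) big_mkord. Qed.

Lemma card_position (lam : seq nat) : #|position lam| = sumn lam.
Proof.
rewrite card_tagged sumnE big_map big_enum /= sumn_nth.
by apply: eq_bigr => i _; rewrite card_ord.
Qed.

Lemma card_position_block (lam : seq nat) (i : 'I_(size lam)) :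
  #|block (@tag _ _ : position lam -> _) i| = nth 0%N lam i.
Proof.
rewrite -[RHS]card_ord -[RHS]cardsT.
pose h (a : 'I_(nth 0%N lam i)) : position lam := existT _ i a.
have h_inj : injective h by move=> a a' /eqP; rewrite eq_Tagged => /eqP.
rewrite -(card_imset _ h_inj); apply: eq_card => u; rewrite inE.
apply/eqP/imsetP => [|[a _ ->] //].
by case: u => i' a /= ii; subst i'; exists a.
Qed.

Lemma card_block_comp (P I J : finType) (b : P -> J) (phi : J -> I) i :
  #|block (fun u => phi (b u)) i| = (\sum_(j | phi j == i) #|block b j|)%N.
Proof.
rewrite -sum1_card (partition_big b (fun j => phi j == i)) /= => [|u]; last first.
  by rewrite inE.
apply: eq_bigr => j /eqP <-; rewrite -sum1_card; apply: eq_bigl => u.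
by rewrite !inE; case: (b u =P j) => [->|]; rewrite ?eqxx ?andbF.
Qed.

Lemma proper_nth_gt0 (k : nat) (lam : seq nat) (i : 'I_(size lam)) :
  proper_partition k lam -> (0 < nth 0 lam i)%N.
Proof. by case=> _ /allP pos _; apply: pos; rewrite mem_nth. Qed.

(** * The two implications *)

(** Tests on the parts of the finer partition combine into tests on the parts of
    the coarser one. *)
Lemma Expand_of_refinement (R : realType) (k : nat) (p : R) (lam lam' : seq nat)
    (H : nat -> uniform_hypergraph k) :
  0 < p < 1 -> sumn lam' = k -> (0 < k)%N -> (forall n, #|vertex (H n)| = n) ->
  refinement lam' lam -> Expand p lam H -> Expand p lam' H.
Proof.
move=> /andP[p0 p1] sumlam k0 cardH [phi [_ phiE]] /ExpandP expand.
apply/ExpandP => e e0.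
have k1 : 0 < k`!%:R :> R by rewrite ltr0n fact_gt0.
have [N HN] := expand (e / (2 * k`!%:R)) (divr_gt0 e0 (mulr_gt0 (ltr0Sn R 1) k1)).
pose N1 := Num.Def.archi_bound (k%:R ^+ 2 / (e / 2)).
exists (maxn N N1.+1) => n; rewrite geq_max => /andP[Nn N1n].
have n0 : (0 < #|vertex (H n)|)%N by rewrite cardH (leq_trans _ N1n).
pose b' : position lam' -> 'I_(size lam') := @tag _ _.
pose b u := phi (b' u).
have cb i : #|block b i| = nth 0%N lam i.
  by rewrite card_block_comp phiE; apply: eq_bigr => j _; apply: card_position_block.
have cP : #|position lam'| = k by rewrite card_position.
have p01 : 0 <= p <= 1 by rewrite !ltW.
have tuples := tuple_of_set_bounded n0 cb p01 (HN n Nn).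
rewrite cP in tuples.
apply: (set_of_tuple_bounded n0 (@card_position_block lam')) => g glocal.
pose g1 i (x : {ffun position lam' -> vertex (H n)}) :=
  [forall j, (phi j == i) ==> g j x].
have g1local : block_local b g1.
  move=> i x y xy; apply: eq_forallb => j; case: eqP => //= ji.
  by apply: glocal => u uj; apply: xy; rewrite /b /b' uj.
have gg x : [forall j, g j x] = [forall i, g1 i x].
  apply/forallP/forallP => [gx i|gx j].
    by apply/forallP => j; apply/implyP.
  by have /forallP/(_ j)/implyP := gx (phi j); apply.
rewrite (eq_bigr (fun x => [forall i, g1 i x]%:R * ((tuple_range x \in edges (H n))%:R - p))).
  apply: le_trans (tuples _ g1local) _.
  have -> : k`!%:R * (e / (2 * k`!%:R) * n%:R ^+ k) = e / 2 * n%:R ^+ k.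
    by field; rewrite gt_eqF.
  have -> : e * n%:R ^+ k = e / 2 * n%:R ^+ k + e / 2 * n%:R ^+ k by field.
  rewrite lerD2l; have := @noninjective_le R (position lam') _ (e / 2) n0.
  rewrite cP cardH; apply; rewrite mulrC -ler_pdivrMr ?divr_gt0 //.
  apply: (@le_trans _ _ N1%:R); last by rewrite ler_nat ltnW.
  by apply/ltW/archi_boundP; rewrite divr_ge0 ?sqr_ge0 // divr_ge0 // ltW.
by move=> x _; rewrite gg.
Qed.

Lemma largest_odd_prime (n : nat) : (9 <= n)%N -> exists q,
  [/\ prime q, odd q, (q ^ 2 <= n)%N &
    forall q', prime q' -> odd q' -> (q' ^ 2 <= n)%N -> (q' <= q)%N].
Proof.
move=> n9; (* The bound 9 is the square of the first odd prime. *)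
pose good q := [&& prime q, odd q & (q ^ 2 <= n)%N].
have ex : exists q, good q by exists 3%N; rewrite /good n9.
have bound q : good q -> (q <= n)%N.
  by case/and3P => _ _; apply: leq_trans; rewrite -{1}[q]expn1; case: q => [|q] //;
     rewrite leq_pexp2l.
case: (ex_maxnP ex bound) => q /and3P[qp qo qn] qmax; exists q; split => //.
by move=> q' q'p q'o q'n; apply: qmax; rewrite /good q'p q'o.
Qed.

Lemma odd_prime_above (x : nat) : exists q, [/\ prime q, odd q & (x < q)%N].
Proof.
have [q xq qp] := prime_above (x + 2)%N; exists q; split => //.
  by case: (even_prime qp) => // q2; move: xq; rewrite q2 addn2.
by apply: leq_trans xq; rewrite ltnS leq_addr.
Qed.

(** Without a refinement, the quadratic hypergraphs over the largest prime field
    that [n] vertices allow satisfy the first property, because their error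
    [delta] decreases with [q], while the planted families keep a fixed positive
    density and span edges only. *)
Lemma refinement_of_Expand (R : realType) (k : nat) (p : R) (lam lam' : seq nat) :
  0 < p < 1 -> proper_partition k lam -> proper_partition k lam' ->
  (forall H : nat -> uniform_hypergraph k,
     (forall n, #|vertex (H n)| = n) -> Expand p lam H -> Expand p lam' H) ->
  refinement lam' lam.
Proof.
move=> p01 hlam hlam' implies; have [size2 _ sumk] := hlam.
have [size2' _ sumk'] := hlam'; have /andP[p0 p1] := p01.
apply: contrapT => norefine.
pose r := size lam'; pose m (j : 'I_r) := nth 0%N lam' j.
have r0 : (0 < r)%N by apply: leq_trans size2'.
pose j0 : 'I_r := Ordinal r0.
pose P := position lam; pose b : P -> 'I_(size lam) := @tag _ _.
have cP : #|P| = k by rewrite card_position.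
have summ : (\sum_j m j = #|P|)%N by rewrite cP -sumk' sumn_nth.
have crossing (chi : {ffun P -> 'I_r}) : exists u v,
    grouping m chi j0 [set: P] u = grouping m chi j0 [set: P] v /\ b u != b v.
  apply: (@crossing_pair P _ _ b (fun i => nth 0%N lam i)).
  - exact: card_position_block.
  - by move=> i; apply: proper_nth_gt0 hlam.
  - by move=> j; apply: proper_nth_gt0 hlam'.
  - by rewrite card_ord.
  case=> phi phiE; apply: norefine; exists phi; split => // i.
  have : (0 < \sum_(j | phi j == i) m j)%N by rewrite -phiE (proper_nth_gt0 _ hlam).
  case: (pickP (fun j => phi j == i)) => [j /eqP ji _|none]; first by exists j.
  by rewrite big_pred0.
have hyp n : exists H : uniform_hypergraph k, #|vertex H| = n /\
  ((9 <= n)%N -> exists q (S : 'I_r -> {set {set vertex H}}),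
    [/\ forall q', prime q' -> odd q' -> (q' ^ 2 <= n)%N -> (q' <= q)%N,
      forall delta : R, 0 <= delta -> 6 <= delta ^+ 2 * q%:R ->
        tuple_bounded b (edges H) p (r%:R ^+ #|P| * (delta * n%:R ^+ #|P|) +
          #|[set x : {ffun P -> vertex H} | ~~ injectiveb x]|%:R),
      forall j, S j \subset [set A : {set vertex H} | #|A| == m j],
      forall s : {ffun 'I_r -> {set vertex H}},
        (forall j, s j \in S j) -> \bigcup_j s j \in edges H
    & 2 * (r%:R + 1) <= p * q%:R -> (2 * r * #|P|.+1 <= n)%N ->
      forall j, planted_density p r #|P| * n%:R ^+ m j <= #|S j|%:R]).
  (* No suitable field exists for n < 9; any hypergraph will do there. *)
have [n9|n9] := leqP 9 n; last first.
    have emptyk (A : {set 'I_n}) : A \in (finset.set0 : {set {set 'I_n}}) -> #|A| = k.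
      by rewrite inE.
    by exists (UniformHypergraph emptyk); split; first exact: card_ord.
  have [q [qp qo qn qmax]] := largest_odd_prime n9.
  have [E [S [Ek Eb Ssub SE Ssize]]] :=
    quadratic_construction p01 summ crossing qp qo qn.
  rewrite cP in Ek.
  exists (UniformHypergraph Ek); split; first exact: card_ord.
  by move=> _; exists q, S.
have [H HP] := boolp.choice hyp.
have cardH n : #|vertex (H n)| = n by have [] := HP n.
have large x : exists N, forall n, (N <= n)%N -> (9 <= n)%N /\
    exists2 q, [/\ prime q, odd q & (q ^ 2 <= n)%N] & (x < q)%N.
  have [q [qp qo xq]] := odd_prime_above x.
  exists (maxn 9 (q ^ 2)) => n; rewrite geq_max => /andP[n9 qn].
  by split => //; exists q.
have expand : Expand p lam H.
  apply/ExpandP => e e0.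
  have rk0 : 0 < r%:R ^+ k :> R by rewrite exprn_gt0 // ltr0n.
  pose delta := e / 2 / r%:R ^+ k.
  have delta0 : 0 < delta by rewrite !divr_gt0.
  pose x := Num.Def.archi_bound (6 / delta ^+ 2).
  pose N1 := Num.Def.archi_bound (k%:R ^+ 2 / (e / 2)).
  have [N HN] := large x.
  exists (maxn N N1) => n; rewrite geq_max => /andP[Nn N1n].
  have [n9 [q' [q'p q'o q'n] xq']] := HN n Nn.
  have [_ /(_ n9)[q [S [qmax bounded _ _ _]]]] := HP n.
  have n0 : (0 < #|vertex (H n)|)%N by rewrite cardH; apply: leq_trans n9.
  have deltaq : 6 <= delta ^+ 2 * q%:R.
    rewrite mulrC -ler_pdivrMr ?exprn_gt0 //.
    apply: (@le_trans _ _ x%:R).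
      by apply/ltW/archi_boundP; rewrite divr_ge0 ?sqr_ge0.
    by rewrite ler_nat (leq_trans (ltnW xq')) // qmax.
  have := bounded delta (ltW delta0) deltaq.
  move=> /(set_of_tuple_bounded n0 (@card_position_block lam)).
  apply: set_bounded_le; rewrite cP.
  have -> : r%:R ^+ k * (delta * n%:R ^+ k) = e / 2 * n%:R ^+ k.
    by rewrite /delta; field; rewrite gt_eqF.
  have -> : e * n%:R ^+ k = e / 2 * n%:R ^+ k + e / 2 * n%:R ^+ k by field.
  rewrite lerD2l; have := @noninjective_le R P _ (e / 2) n0.
  rewrite cP cardH; apply; rewrite mulrC -ler_pdivrMr ?divr_gt0 //.
  apply: (@le_trans _ _ N1%:R); last by rewrite ler_nat.
  by apply/ltW/archi_boundP; rewrite divr_ge0 ?sqr_ge0 // divr_ge0 // ltW.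
have /ExpandP expand' := implies H cardH expand.
pose dens := planted_density p r k.
have dens0 : 0 < dens.
  have r0R : 0 < 2 * r%:R :> R by rewrite mulr_gt0 // ltr0n.
  by rewrite !divr_gt0 // mulr_gt0 ?exprn_gt0 // ltr0n fact_gt0.
(* All tuples from the planted families are edges, so their deviation is at
   least (1 - p) * dens ^+ r * n ^+ k, twice the error allowed for this e. *)
pose e := (1 - p) * dens ^+ r / 2.
have e0 : 0 < e by rewrite divr_gt0 // mulr_gt0 ?exprn_gt0 // subr_gt0.
pose x := Num.Def.archi_bound (2 * (r%:R + 1) / p).
have [N HN] := large x; have [N' HN'] := expand' e e0.
pose n := maxn (maxn N N') (2 * r * k.+1).
have nN : (N <= n)%N by rewrite /n !leq_max leqnn.
have nN' : (N' <= n)%N by rewrite /n !leq_max leqnn orbT.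
have [n9 [q' [q'p q'o q'n] xq']] := HN n nN.
have [_ /(_ n9)[q [S [qmax _ Ssub SE Ssize]]]] := HP n.
have rq : 2 * (r%:R + 1) <= p * q%:R.
  rewrite mulrC [p * _]mulrC -ler_pdivrMr // [_ * 2]mulrC.
  apply: (@le_trans _ _ x%:R).
    by apply/ltW/archi_boundP; rewrite divr_ge0 ?mulr_ge0 ?addr_ge0 // ltW.
  by rewrite ler_nat (leq_trans (ltnW xq')) // qmax.
have kn : (2 * r * #|P|.+1 <= n)%N by rewrite cP /n leq_max leqnn orbT.
have dev : family_deviation (edges (H n)) p S = (1 - p) * \prod_j #|S j|%:R.
  rewrite family_deviationE prod_card_families mulr_sumr; apply: eq_bigr => s _.
  by case: forallP => [sS|_]; rewrite ?mul0r ?mulr0 // SE // mul1r mulr1.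
have p'0 : 0 <= 1 - p by rewrite subr_ge0 ltW.
have prod0 : 0 <= (1 - p) * \prod_j #|S j|%:R by rewrite mulr_ge0 ?prodr_ge0.
have := HN' n nN' S Ssub; rewrite dev (ger0_norm prod0).
apply/negP; rewrite -ltNge.
have n0 : 0 < n%:R :> R by rewrite ltr0n (leq_trans _ n9).
apply: (@lt_le_trans _ _ ((1 - p) * (dens ^+ r * n%:R ^+ k))).
  rewrite /e mulrA ltr_pM2r ?exprn_gt0 // gtr_pMr.
    by rewrite invf_lt1 // ltr1n.
  by rewrite mulr_gt0 ?exprn_gt0 // subr_gt0.
apply: ler_wpM2l => //.
have -> : dens ^+ r * n%:R ^+ k = \prod_(j < r) (dens * n%:R ^+ m j).
  rewrite big_split /= prodr_const card_ord; congr (_ * _).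
  by rewrite -cP -summ expr_sum.
apply: ler_prod => j _; apply/andP; split.
  by rewrite mulr_ge0 ?exprn_ge0 // ltW.
by have := Ssize rq kn j; rewrite cP.
Qed.


Theorem theorem3 (R : realType) (k : nat) (p : R) (lam lam' : seq nat)
    (hk : (2 <= k)%N) (hp : 0 < p < 1)
    (hlam : proper_partition k lam) (hlam' : proper_partition k lam') :
  (forall H : nat -> uniform_hypergraph k,
     (forall n, #|vertex (H n)| = n) ->
     Expand p lam H -> Expand p lam' H)
  <-> refinement lam' lam.
Proof.
split; first exact: refinement_of_Expand.
move=> refines H cardH; apply: Expand_of_refinement => //.
- by case: hlam'.
- exact: leq_trans hk.
Qed.
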